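(* The spectrum of nim numbers of avoidance games on vertex geometries of trees is $\{0,1,2,3\}$; that is, the set of all values $\mathrm{nim}(\mathrm{DNG}(S,W))$, where $(S,\mathcal{K})$ ranges over the vertex geometries of trees and $W$ over nonempty subsets of $S$, equals $\{0,1,2,3\}$.
   Context: The vertex geometry of a finite tree $T$ with vertex set $S$ is the convex geometry $(S,\mathcal{K})$ where $\mathcal{K}$ consists of the vertex sets of connected subgraphs of $T$ (the empty set included). The convex closure operator is $\tau(A)=\bigcap\{K\in\mathcal{K}\mid A\subseteq K\}$ for $A\subseteq S$. Avoidance game $\mathrm{DNG}(S,W)$, for nonempty $W\subseteq S$: two players alternately choose previously unchosen points of $S$, starting from the empty set of chosen points; a player may choose a point only if, with $P$ the set of all jointly chosen points after the move, $W\not\subseteq\tau(P)$. The last player able to move wins. The nim number of a position $P$ is defined recursively by $\mathrm{nim}(P)=\mathrm{mex}\{\mathrm{nim}(Q)\mid Q\in\mathrm{Opt}(P)\}$, where $\mathrm{Opt}(P)$ is the set of positions reachable from $P$ in one legal move and $\mathrm{mex}(A)$ is the smallest nonnegative integer not in $A$; the nim number of the game is that of its starting position $\emptyset$. *)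

(* Defs.v *)
From mathcomp Require Import all_boot.

Set Implicit Arguments.
Unset Strict Implicit.
Unset Printing Implicit Defensive.

Section Trees.
Variable S : finType.

Definition connected_on (V : {set S}) (r : rel S) : bool :=
  [forall x in V, forall y in V, connect r x y].

(* Cycles of a simple graph have at least three vertices: [ucycle e] also
   accepts [:: x; y] for an edge xy. *)
Definition tree (e : rel S) : Prop :=
  [/\ symmetric e, irreflexive e, (0 < #|S|)%N, connected_on [set: S] e
    & forall c : seq S, ucycle e c -> size c <= 2].

(* (V, E) is a subgraph of the graph e; an edge is stored in E in both
   orientations. *)
Definition subgraph (e : rel S) (V : {set S}) (E : {set S * S}) : bool :=
  [forall u, forall v, ((u, v) \in E) ==>
     [&& u \in V, v \in V, e u v & (v, u) \in E]].

(* The null graph is vacuously connected, so set0 belongs to this family. *)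
Definition vertex_geometry (e : rel S) : {set {set S}} :=
  [set K : {set S} | [exists E : {set S * S},
     subgraph e K E && connected_on K (fun u v => (u, v) \in E)]].

End Trees.

Fact mex_ex (s : seq nat) : exists n, n \notin s.
Proof.
exists (\max_(i <- s) i).+1; apply/negP => h.
by have := @leq_bigmax_seq _ s xpredT id _ h isT; rewrite ltnn.
Qed.

Definition mex (s : seq nat) : nat := ex_minn (mex_ex s).

Section Avoidance.
Variables (S : finType) (K : {set {set S}}) (W : {set S}).

Definition closure_op (A : {set S}) : {set S} :=
  \bigcap_(C in K | A \subset C) C.

Definition Opt (P : {set S}) : {set {set S}} :=
  [set p |: P | p in ~: P & ~~ (W \subset closure_op (p |: P))].

(* A play from P has at most #|~: P| moves, so this fuel suffices; the
   recursive equation is nimE below. *)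
Fixpoint nim_fuel (k : nat) (P : {set S}) : nat :=
  if k is k'.+1 then mex [seq nim_fuel k' Q | Q <- enum (Opt P)] else 0.

Definition nim (P : {set S}) : nat := nim_fuel #|~: P| P.

Lemma nimE (P : {set S}) : nim P = mex [seq nim Q | Q <- enum (Opt P)].
Proof.
have optC Q : Q \in Opt P -> #|~: P| = #|~: Q|.+1.
  case/imsetP => p; rewrite !inE => /andP[pP _] ->.
  by rewrite (cardsD1 p (~: P)) inE pP setCU setDE setIC.
rewrite /nim; case E: #|~: P| => [|k] /=; last first.
  congr mex; apply/eq_in_map => Q; rewrite mem_enum => /optC.
  by rewrite E => -[->].
rewrite (_ : Opt P = set0) ?enum_set0 /=.
  by apply/esym/eqP; rewrite -leqn0 /mex; case: ex_minnP => m _; apply.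
by apply/setP => Q; rewrite [in RHS]inE; apply/negP => /optC; rewrite E.
Qed.

Definition nim_DNG : nat := nim set0.

End Avoidance.

(* Main.v *)
Require Import Defs.
From mathcomp Require Import all_boot zify.

Set Implicit Arguments.
Unset Strict Implicit.
Unset Printing Implicit Defensive.

(** A vertex w lies outside the closure of a nonempty set P exactly when P is
    contained in one branch at w, that is, in one connected component of the
    graph with w deleted.  Hence a position is legal when it fits in a branch
    at some point of W, and only the inclusion-maximal such branches matter.

    If W is a singleton, the branches are pairwise disjoint: the first move
    selects one of them, the rest of the play merely fills it, and every
    position after the first move has nim number 0 or 1 by parity.  So the nim
    number of the game is at most 2 ([nim_caged_start]).

    If W has at least two points, the complements of the maximal branches are
    pairwise disjoint ([gates_disjoint]).  The game becomes: given disjoint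
    nonempty sets, called blockers, choose points without ever hitting all of
    them.  When only one blocker B is unhit, the play fills the complement of B,
    so the parity of that complement decides the outcome.  With several unhit
    blockers these parities vote ([nim_blocked]): if a strict majority of the
    complements has one parity, the nim number is 0 or 1 as if only blockers of
    that parity were left; in a tie, hitting a blocker of either kind breaks it
    and reaches both 0 and 1, so the position has nim number 2 or 3, according
    to the parity of the number of points that can be chosen without hitting a
    further blocker.  Thus the nim number is at most 3.

    All four values occur on paths when W consists of an end of the path and
    one other vertex: there are then just two blockers, and [nim_path] reads the
    nim number off their sizes. *)

(** * Nim numbers of avoidance games with a disjointness structure *)

Lemma setU1_neq0 (T : finType) (x : T) (A : {set T}) : x |: A != set0.
Proof. by apply/set0Pn; exists x; rewrite setU11. Qed.

Section Game.
Variables (S : finType) (K : {set {set S}}) (W : {set S}).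
Implicit Types (P Q : {set S}) (B C : {set S}).

Lemma nim_below P m : m < nim K W P -> exists2 Q, Q \in Opt K W P & nim K W Q = m.
Proof.
rewrite nimE /mex; case: ex_minnP => n _ min_n lt_mn.
have : m \in [seq nim K W Q | Q <- enum (Opt K W P)].
  by apply/negPn/negP => /min_n; rewrite leqNgt lt_mn.
by case/mapP => Q; rewrite mem_enum => QP ->; exists Q.
Qed.

Lemma nim_eq P n :
    (forall Q, Q \in Opt K W P -> nim K W Q != n) ->
    (forall m, m < n -> exists2 Q, Q \in Opt K W P & nim K W Q = m) ->
  nim K W P = n.
Proof.
move=> nimN below; rewrite nimE /mex; case: ex_minnP => m mN min_m.
apply/eqP; rewrite eqn_leq; apply/andP; split.
  apply: min_m; apply/mapP => -[Q]; rewrite mem_enum => /nimN/negP nQ def_n.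
  by apply: nQ; rewrite def_n.
rewrite leqNgt; apply: contra mN => /below[Q QP <-].
by apply/mapP; exists Q; rewrite ?mem_enum.
Qed.

Lemma OptP P Q :
  reflect (exists p, [/\ p \notin P, Q = p |: P &
                         ~~ (W \subset closure_op K (p |: P))])
          (Q \in Opt K W P).
Proof.
apply: (iffP imsetP) => [[p]|[p [pP -> legal]]].
  by rewrite !inE => /andP[pP legal] ->; exists p.
by exists p; rewrite ?inE ?pP.
Qed.

Lemma card_setC_move p P : p \notin P -> #|~: (p |: P)| < #|~: P|.
Proof.
by move=> pP; apply: proper_card; rewrite properC properUr ?sub1set.
Qed.

Section Caged.
Variable cages : {set {set S}}.
Hypothesis cages_disjoint : trivIset cages.
Hypothesis legal_cage : forall P, P != set0 ->
  (W \subset closure_op K P) = ~~ [exists C in cages, P \subset C].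

(** Disjointness makes the cage containing a nonempty position unique, so the
    play from there consists in filling that cage. *)
Lemma nim_caged P C :
  P != set0 -> C \in cages -> P \subset C -> nim K W P = odd #|C :\: P|.
Proof.
have [n] := ubnP #|~: P|; elim: n P => // n IHn P leP P0 CC sPC.
have [x xP] := set0Pn _ P0.
have nimQ Q : Q \in Opt K W P -> nim K W Q = ~~ odd #|C :\: P|.
  case/OptP => p [pP -> ]; rewrite legal_cage ?setU1_neq0 // negbK.
  case/exists_inP => D DC sQD.
  have defD : D = C.
    apply/eqP; apply: contraTT (subsetP sPC _ xP) => neqDC.
    have /disjointFr-> // : [disjoint D & C] by apply: (trivIsetP cages_disjoint).
    by rewrite (subsetP sQD) // setU1r.
  rewrite {D DC}defD in sQD.
  have pC : p \in C by rewrite (subsetP sQD) // setU11.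
  rewrite IHn ?setU1_neq0 //; last first.
    by rewrite -ltnS (leq_trans _ leP) // ltnS card_setC_move.
  rewrite (cardsD1 p (C :\: P)) inE pP pC /= negbK.
  by rewrite setDDl setUC.
case: (set_0Vmem (C :\: P)) => [CP0|[p]].
  apply: nim_eq => [Q QP|]; last by rewrite CP0 cards0.
  by rewrite nimQ // CP0 cards0.
rewrite inE => /andP[pP pC].
apply: nim_eq => [Q /nimQ->|m]; first by case: odd.
case odd_CP: (odd _) => //; rewrite ltnS leqn0 => /eqP->.
have QP : p |: P \in Opt K W P.
  apply/OptP; exists p; split=> //; rewrite legal_cage ?setU1_neq0 // negbK.
  by apply/exists_inP; exists C; rewrite // subUset sub1set pC.
by exists (p |: P); rewrite // nimQ // odd_CP.
Qed.

(** All options of the empty position have nim number 0 or 1, so 2 cannot be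
    among them. *)
Lemma nim_caged_start : nim K W set0 <= 2.
Proof.
rewrite leqNgt; apply/negP => /nim_below[Q /OptP[p [_ -> ]]].
rewrite legal_cage ?setU1_neq0 // negbK => /exists_inP[C CC sC].
by rewrite (@nim_caged _ C) ?setU1_neq0 //; case: odd.
Qed.

End Caged.

Section Blockers.
Variable blockers : {set {set S}}.
Hypothesis blockers_disjoint : trivIset blockers.
Hypothesis blockers_neq0 : set0 \notin blockers.
Hypothesis legal_block : forall P, P != set0 ->
  (W \subset closure_op K P) = ~~ [exists B in blockers, [disjoint B & P]].

Definition unhit P := [set B in blockers | [disjoint B & P]].
(** The points that can be chosen without changing the set of unhit blockers. *)
Definition free P := ~: (P :|: cover (unhit P)).
(** An unhit blocker votes for the parity of its complement. *)
Definition weight c P := #|[set B in unhit P | odd #|~: B| == c]|.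

Lemma legal_unhit P :
  P != set0 -> ~~ (W \subset closure_op K P) = (unhit P != set0).
Proof.
move=> P0; rewrite legal_block // negbK; apply/exists_inP/set0Pn => -[B].
  by move=> BF dB; exists B; rewrite inE BF.
by rewrite inE => /andP[]; exists B.
Qed.

Lemma mem_Opt p P :
  p \notin P -> unhit (p |: P) != set0 -> p |: P \in Opt K W P.
Proof.
by move=> pP uQ; apply/OptP; exists p; rewrite legal_unhit ?setU1_neq0.
Qed.

Lemma disjoint_move B p P : [disjoint B & p |: P] = (p \notin B) && [disjoint B & P].
Proof.
by rewrite ![[disjoint B & _]]disjoint_sym !disjoints_subset subUset sub1set inE.
Qed.

Lemma unhit_free p P : p \in free P -> unhit (p |: P) = unhit P.
Proof.
rewrite !inE negb_or => /andP[_ pU]; apply/setP => B; rewrite !inE disjoint_move.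
case BF: (B \in blockers); case dB: [disjoint B & P]; rewrite ?andbF //= andbT.
by apply: contraNN pU => pB; apply/bigcupP; exists B; rewrite // inE BF.
Qed.

(** A move hits at most one blocker; this is where disjointness is used. *)
Lemma unhit_hit p B P : B \in unhit P -> p \in B -> unhit (p |: P) = unhit P :\ B.
Proof.
rewrite inE => /andP[BF dB] pB; apply/setP => D; rewrite !inE disjoint_move.
have [->|neqDB] /= := eqVneq D B; first by rewrite pB andbF.
case DF: (D \in blockers) => //=.
have dDB : [disjoint D & B] by apply: (trivIsetP blockers_disjoint).
by rewrite (disjointFl dDB pB).
Qed.

Lemma weight_free c p P : p \in free P -> weight c (p |: P) = weight c P.
Proof. by move=> pF; rewrite /weight unhit_free. Qed.

Lemma weight_hit c p B P : B \in unhit P -> p \in B ->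
  weight c P = (odd #|~: B| == c) + weight c (p |: P).
Proof.
move=> BU pB; rewrite /weight (unhit_hit BU pB).
rewrite (cardsD1 B [set D in unhit P | _]) [in X in X + _]inE BU /=; congr (_ + _).
by apply: eq_card => D; rewrite !inE andbA.
Qed.

Lemma weight_gt0P c P :
  reflect (exists2 B, B \in unhit P & odd #|~: B| = c) (0 < weight c P).
Proof.
rewrite card_gt0; apply: (iffP (set0Pn _)) => -[B]; last first.
  by move=> BU Bc; exists B; rewrite inE BU Bc eqxx.
by rewrite inE => /andP[BU /eqP]; exists B.
Qed.

Lemma unhit_neq0 c P : 0 < weight c P -> unhit P != set0.
Proof. by case/weight_gt0P=> B BU _; apply/set0Pn; exists B. Qed.

Lemma card_unhit c P : #|unhit P| = weight c P + weight (~~ c) P.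
Proof.
rewrite -(cardsID [set B : {set S} | odd #|~: B| == c]); congr (_ + _).
  by apply: eq_card => B; rewrite !inE.
apply: eq_card => B; rewrite !inE andbC; congr (_ && _).
by case: odd; case: c.
Qed.

Lemma free_notin p P : p \in free P -> p \notin P.
Proof. by rewrite !inE negb_or => /andP[]. Qed.

Lemma unhit_notin p B P : B \in unhit P -> p \in B -> p \notin P.
Proof. by rewrite inE => /andP[_ dB] pB; rewrite (disjointFr dB pB). Qed.

Lemma unhit_point B P : B \in unhit P -> exists p, p \in B.
Proof.
rewrite inE => /andP[BF _]; apply/set0Pn.
by apply: contraNneq blockers_neq0 => <-.
Qed.

Lemma move_cases p P :
  p \notin P -> p \in free P \/ exists2 B, B \in unhit P & p \in B.
Proof.
move=> pP; rewrite !inE (negPf pP) /=.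
by case: (boolP (p \in cover _)) => [/bigcupP[B]|]; [right; exists B | left].
Qed.

Lemma card_free p P : p \in free P -> #|free P| = #|free (p |: P)|.+1.
Proof.
move=> pF; rewrite (cardsD1 p) pF add1n; congr _.+1; apply: eq_card => x.
by rewrite /free (unhit_free pF) !inE; case: (x == p).
Qed.

Lemma odd_move p P : p \notin P -> odd #|p |: P| = ~~ odd #|P|.
Proof. by move=> pP; rewrite cardsU1 pP. Qed.

(** With one unhit blocker left and no free point, the position is final. *)
Lemma lone_blocker B P : unhit P = [set B] -> free P = set0 -> P = ~: B.
Proof.
move=> defU; have : B \in unhit P by rewrite defU set11.
rewrite inE /free defU /cover big_set1 => /andP[_ dB] /setP F0.
apply/setP => x; move: (F0 x); rewrite !inE.
by case xB: (x \in B); rewrite ?(disjointFr dB xB) ?orbF //= => /negbFE.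
Qed.

(** Induction on the number of unchosen points.  A move either keeps all the
    votes or removes a single one, so a majority can at worst turn into a tie,
    whose nim number is at least 2 and does not interfere with the values 0 and 1.
    In a tie both parities have at least one vote, and a move can remove either. *)
Theorem nim_blocked P : unhit P != set0 ->
  (forall c, weight (~~ c) P < weight c P -> nim K W P = odd #|P| (+) c) /\
  (weight false P = weight true P -> nim K W P = 2 + odd #|free P|).
Proof.
have [n] := ubnP #|~: P|; elim: n P => // n IHn P leP U0.
have {IHn leP} IH p : p \notin P -> unhit (p |: P) != set0 ->
  (forall c, weight (~~ c) (p |: P) < weight c (p |: P) ->
     nim K W (p |: P) = ~~ (odd #|P| (+) c)) /\
  (weight false (p |: P) = weight true (p |: P) ->
     nim K W (p |: P) = 2 + odd #|free (p |: P)|).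
  move=> pP; have ltQ : #|~: (p |: P)| < n.
    by rewrite -ltnS (leq_trans _ leP) // ltnS card_setC_move.
  move/(IHn _ ltQ) => [nim_maj nim_tie]; split=> // c /nim_maj->.
  by rewrite odd_move // addNb.
split=> [c maj_c | tie].
  have tie_c p : weight (~~ c) (p |: P) = weight c (p |: P) ->
    weight false (p |: P) = weight true (p |: P) by case: (c).
  apply: nim_eq => [Q /OptP[p [pP -> ]] | m].
    rewrite legal_unhit ?setU1_neq0 // => /(IH p pP)[nim_maj nim_tie].
    (* A move costs c at most one vote, so it leaves at worst a tie. *)
    have : weight (~~ c) (p |: P) <= weight c (p |: P).
      have [pF|[B BU pB]] := move_cases pP; first by rewrite !weight_free // ltnW.
      move: maj_c; rewrite !(weight_hit _ BU pB).
      case: (odd #|_|); case: (c) => //=; rewrite ?add0n ?add1n ?ltnS //.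
        by move/ltnW/ltnW.
      by move/ltnW/ltnW.
    rewrite leq_eqVlt => /predU1P[/tie_c/nim_tie|/(nim_maj c)] ->.
      by case: (_ (+) _); case: odd.
    by case: (_ (+) _).
  case v: (_ (+) _) => //; rewrite ltnS leqn0 => /eqP->.
  (* The position should have nim number 1, so a move to 0 is needed: any move
     that keeps the majority flips the parity of the position. *)
  suff [p pP maj_Q] : exists2 p, p \notin P &
      weight (~~ c) (p |: P) < weight c (p |: P).
    have U0Q := unhit_neq0 (leq_ltn_trans (leq0n _) maj_Q).
    exists (p |: P); first exact: mem_Opt.
    by have [nim_maj _] := IH p pP U0Q; rewrite (nim_maj c) // v.
  have [F0|[p pF]] := set_0Vmem (free P); last first.
    by exists p; rewrite ?free_notin // !weight_free.
  case: (posnP (weight (~~ c) P)) => [w0|/weight_gt0P[B BU Bc]]; last first.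
    have [p pB] := unhit_point BU; exists p; first exact: unhit_notin pB.
    by move: maj_c; rewrite !(weight_hit _ BU pB) Bc eqxx; case: (c) => /ltnW.
  (* Every vote is for c: unless a second vote remains, the position is the
     complement of its only unhit blocker, which has parity c, against v. *)
  have /weight_gt0P[B BU Bc] : 0 < weight c P by apply: leq_trans maj_c.
  have [p pB] := unhit_point BU; exists p; first exact: unhit_notin pB.
  have := w0; rewrite (weight_hit _ BU pB) => /eqP; rewrite addn_eq0 => /andP[_ /eqP->].
  rewrite lt0n; apply/eqP => wQ0.
  have /eqP/cards1P[D defU] : #|unhit P| = 1.
    by rewrite (card_unhit c) w0 (weight_hit c BU pB) wQ0 Bc eqxx.
  have defB : B = D by move: BU; rewrite defU => /set1P.
  by move: v; rewrite (lone_blocker defU F0) -defB Bc addbb.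
have w_gt0 c : 0 < weight c P.
  have : 0 < #|unhit P| by rewrite card_gt0.
  by rewrite (card_unhit true) /= tie addnn double_gt0; case: c; rewrite ?tie.
(* Removing a vote for c gives the majority to the other parity. *)
have hit c : exists2 Q, Q \in Opt K W P & nim K W Q = odd #|P| (+) c.
  have /weight_gt0P[B BU Bc] := w_gt0 c.
  have [p pB] := unhit_point BU; have pP := unhit_notin BU pB.
  have maj_Q : weight c (p |: P) < weight (~~ c) (p |: P).
    have := tie; rewrite !(weight_hit _ BU pB) Bc.
    by case: (c); rewrite /= add0n add1n; [move=> -> | move=> <-].
  have U0Q := unhit_neq0 (leq_ltn_trans (leq0n _) maj_Q).
  exists (p |: P); first exact: mem_Opt.
  have [nim_maj _] := IH p pP U0Q.
  by rewrite (nim_maj (~~ c)) ?negbK // addbN negbK.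
apply: nim_eq => [Q /OptP[p [pP -> ]] | m].
  rewrite legal_unhit ?setU1_neq0 // => /(IH p pP)[nim_maj nim_tie].
  have [pF|[B BU pB]] := move_cases pP.
    by rewrite nim_tie ?weight_free // (card_free pF) /=; case: odd.
  rewrite (nim_maj (~~ odd #|~: B|)); first by case: (odd #|P|); case: (odd #|~: B|); case: odd.
  have := tie; rewrite !(weight_hit _ BU pB).
  by case: (odd #|~: B|); rewrite /= add0n add1n; [move=> -> | move=> <-].
case: m => [|[|m]] lt_m.
- by have [Q QP nQ] := hit (odd #|P|); exists Q; rewrite // nQ addbb.
- by have [Q QP nQ] := hit (~~ odd #|P|); exists Q; rewrite // nQ addbN addbb.
(* In a tie of value 3 a free point remains, and choosing it keeps the tie and
   gives value 2. *)
have [-> oddF] : m = 0 /\ odd #|free P|.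
  by move: lt_m; case: odd => //; case: m.
have /card_gt0P[p pF] : 0 < #|free P| by case: #|_| oddF.
have U0Q : unhit (p |: P) != set0 by rewrite unhit_free.
exists (p |: P); first by rewrite mem_Opt ?free_notin.
have [_ ->] := IH p (free_notin pF) U0Q; last by rewrite !weight_free.
by move: oddF; rewrite (card_free pF) /= => /negPf->.
Qed.

Lemma nim_blocked_start : blockers != set0 -> nim K W set0 <= 3.
Proof.
move=> nz; have U0 : unhit set0 != set0.
  apply: contraNneq nz => U0; rewrite -U0; apply/eqP/setP => B.
  by rewrite inE disjoints_subset setC0 subsetT andbT.
have [nim_maj nim_tie] := nim_blocked U0.
have [lt|lt|eq] := ltngtP (weight false set0) (weight true set0).
- by rewrite (nim_maj true) //; case: (_ (+) _).
- by rewrite (nim_maj false) //; case: (_ (+) _).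
by rewrite nim_tie //; case: odd.
Qed.

Lemma nim_blocked_pair_start A B : blockers = [set A; B] -> A != B ->
  nim K W set0 = if odd #|~: A| == odd #|~: B| then odd #|~: A| : nat
                 else 2 + odd #|~: (A :|: B)|.
Proof.
move=> defF neqAB; have defU : unhit set0 = [set A; B].
  by apply/setP => D; rewrite inE defF disjoints_subset setC0 subsetT andbT.
have AnB : A \notin [set B] by rewrite inE.
have wE c : weight c set0 = (odd #|~: A| == c) + (odd #|~: B| == c).
  rewrite /weight defU -sum1dep_card big_mkcondr big_setU1 //= big_set1.
  by do 2!case: eqP.
have [|nim_maj nim_tie] := @nim_blocked set0; first by rewrite defU setU1_neq0.
case: eqP => [eqAB | neq].
  rewrite (nim_maj (odd #|~: A|)) ?cards0 // !wE -eqAB.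
  by case: odd.
rewrite nim_tie ?wE; last by move: neq; do 2!case: odd.
by rewrite /free defU /cover big_setU1 //= big_set1 set0U.
Qed.

End Blockers.
End Game.

(** * Branches of a connected graph and the closure operator *)

Section Branches.
Variables (S : finType) (e : rel S).
Hypotheses (sym_e : symmetric e) (conn_e : connected_on [set: S] e).
Local Notation convex := (vertex_geometry e).

Implicit Types (C P W Z : {set S}).

Definition induced (Z : {set S}) := [rel x y | [&& x \in Z, y \in Z & e x y]].

Lemma induced_sym Z : symmetric (induced Z).
Proof. by move=> x y; rewrite /= andbCA sym_e. Qed.

(** Among the subgraphs with vertex set Z the induced one has the most edges, so
    it is connected if any of them is. *)
Lemma convexP (Z : {set S}) :
  reflect {in Z &, forall x y, connect (induced Z) x y} (Z \in convex).
Proof.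
apply: (iffP idP) => [|conn_Z].
  rewrite inE => /existsP[E /andP[/'forall_forallP sE /'forall_in_forall_inP cE]].
  move=> x y xZ yZ; have := cE x xZ y yZ; apply: connect_sub => u v uvE.
  by apply: connect1; have := sE u v; rewrite uvE => /and4P[/= -> -> ->].
rewrite inE; apply/existsP; exists [set uv | induced Z uv.1 uv.2].
apply/andP; split.
  apply/'forall_forallP => u v; apply/implyP; rewrite !inE /=.
  by case/and3P=> -> -> uv; rewrite uv sym_e.
apply/'forall_in_forall_inP => x xZ y yZ.
by apply: connect_sub (conn_Z x y xZ yZ) => u v uv; apply: connect1; rewrite inE.
Qed.

Lemma convex_star (Z : {set S}) w :
    (forall z, z \in Z ->
       exists Y, [/\ Y \in convex, w \in Y, z \in Y & Y \subset Z]) ->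
  Z \in convex.
Proof.
move=> star; have conn_w z : z \in Z -> connect (induced Z) w z.
  case/star => Y [/convexP cY wY zY /subsetP sYZ].
  apply: connect_sub (cY w z wY zY) => u v /and3P[uY vY uv].
  by apply: connect1; rewrite /= !sYZ.
apply/convexP => x y /conn_w wx /conn_w; apply: connect_trans.
by rewrite (sym_connect_sym (induced_sym Z)).
Qed.

(** The component of x once w is deleted; for x = w the value is just [set w]. *)
Definition branch w x := [set y | connect (induced [set~ w]) x y].

Lemma branch_sym w : connect_sym (induced [set~ w]).
Proof. exact/sym_connect_sym/induced_sym. Qed.

Lemma branch_refl w x : x \in branch w x.
Proof. by rewrite inE. Qed.

Lemma branch_eq w x y : y \in branch w x -> branch w y = branch w x.
Proof.
by rewrite inE => xy; apply/setP => z; rewrite !inE (same_connect (@branch_sym w) xy).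
Qed.

Lemma cut_notin_branch w x : x != w -> w \notin branch w x.
Proof.
move=> neq_xw; rewrite inE; apply/negP.
have cl : closed (induced [set~ w]) [set~ w] by move=> u v /and3P[-> ->].
by move/(closed_connect cl); rewrite !inE neq_xw eqxx.
Qed.

Lemma convex_sub_branch Z w x :
  Z \in convex -> w \notin Z -> x \in Z -> Z \subset branch w x.
Proof.
move=> /convexP cZ wZ xZ; apply/subsetP => y yZ; rewrite inE.
apply: connect_sub (cZ x y xZ yZ) => u v /and3P[uZ vZ uv].
apply: connect1; rewrite /= !inE uv andbT.
by apply/andP; split; apply: contraNneq wZ => <-.
Qed.

Lemma branch_convex w x : branch w x \in convex.
Proof.
apply/convexP => y z yB zB; have : z \in branch w y by rewrite (branch_eq yB).
rewrite inE => /connectP[p yp ->] {z zB}.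
elim: p y yB yp => //= a p IHp y yB /andP[ya ap].
have aB : a \in branch w x.
  by move: yB; rewrite !inE => /connect_trans; apply; apply: connect1.
apply: connect_trans (IHp a aB ap); apply: connect1.
by rewrite /= yB aB; case/and3P: ya.
Qed.

Lemma set1_convex w : [set w] \in convex.
Proof. by apply/convexP => x y /set1P-> /set1P->. Qed.

Lemma edge_convex x y : e x y -> [set x; y] \in convex.
Proof.
move=> xy; apply/convexP => u v.
do 2!case/set2P=> ->; rewrite ?connect0 // connect1 //= !inE !eqxx ?orbT //.
by rewrite sym_e.
Qed.

(** Connectedness of the graph provides an edge from w into each branch at w. *)
Lemma branch_root_convex w x : x != w -> w |: branch w x \in convex.
Proof.
move=> neq_xw.
have [y yB wy] : exists2 y, y \in branch w x & e w y.
  apply/exists_inP; apply: contraT => /exists_inPn wN.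
  have cl : closed e (branch w x).
    apply: (intro_closed (sym_connect_sym sym_e)) => u v uv uB.
    have uw : u != w by apply: contraTneq uB => ->; apply: cut_notin_branch.
    have vw : v != w by apply: contraTneq uv => ->; rewrite sym_e wN.
    move: uB; rewrite !inE => /connect_trans; apply; apply: connect1.
    by rewrite /= !inE uw vw.
  have /(closed_connect cl) : connect e x w.
    by have /forall_inP/(_ x _)/forall_inP->  := conn_e; rewrite ?inE.
  by rewrite branch_refl (negPf (cut_notin_branch neq_xw)).
apply: (@convex_star _ y) => z /setU1P[->|zB].
  exists [set w; y]; split; rewrite ?edge_convex ?inE ?eqxx ?orbT //.
  by rewrite subUset !sub1set setU11 setU1r.
by exists (branch w x); rewrite branch_convex yB subsetUr.
Qed.

(** The complement is w together with the other branches at w, all joined at w. *)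
Lemma setC_branch_convex w x : x != w -> ~: branch w x \in convex.
Proof.
move=> neq_xw; have wB := cut_notin_branch neq_xw.
apply: (@convex_star _ w) => z; rewrite inE => zB.
have [->|neq_zw] := eqVneq z w.
  by exists [set w]; rewrite set1_convex sub1set !in_set1 inE wB eqxx.
exists (w |: branch w z); rewrite branch_root_convex // setU11 setU1r ?branch_refl //.
split=> //; rewrite subUset sub1set inE wB; apply/subsetP => t tz.
rewrite inE; apply: contraNN zB => tx.
by rewrite -(branch_eq tx) (branch_eq tz) branch_refl.
Qed.

(** A convex set that avoids w lies within one branch at w, and branches at w are
    themselves convex sets avoiding w. *)
Lemma notin_closureP w P : P != set0 ->
  reflect (exists2 x, x != w & P \subset branch w x) (w \notin closure_op convex P).
Proof.
move=> P0; apply: (iffP idP) => [wP | [y neq_yw sP]].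
  have [x xP] := set0Pn _ P0.
  have [Z /andP[cZ sPZ] wZ] : exists2 Z, (Z \in convex) && (P \subset Z) & w \notin Z.
    apply/exists_inP; apply: contraNT wP => /exists_inPn wN.
    by apply/bigcapP => Z /wN; rewrite negbK.
  have xZ := subsetP sPZ x xP; exists x; first by apply: contraNneq wZ => <-.
  by apply: subset_trans sPZ _; apply: convex_sub_branch.
apply/bigcapP => /(_ (branch w y)); rewrite branch_convex sP => /(_ isT).
exact/negP/cut_notin_branch.
Qed.

Definition branches (W : {set S}) :=
  [set C | [exists w in W, exists x, (x != w) && (C == branch w x)]].

Lemma branchesP W C :
  reflect (exists w x, [/\ w \in W, x != w & C = branch w x]) (C \in branches W).
Proof.
rewrite inE; apply: (iffP exists_inP) => [[w wW] | [w [x [wW xw ->]]]].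
  by case/existsP=> x /andP[xw /eqP]; exists w, x.
by exists w => //; apply/existsP; exists x; rewrite xw eqxx.
Qed.

Lemma legal_branches W P : P != set0 ->
  (W \subset closure_op convex P) = ~~ [exists C in branches W, P \subset C].
Proof.
move=> P0; rewrite -[LHS]negbK; congr (~~ _).
apply/subsetPn/exists_inP => [[w wW /(notin_closureP w P0)[x xw sP]] | [C]].
  by exists (branch w x) => //; apply/branchesP; exists w, x.
case/branchesP=> w [x [wW xw ->]] sP; exists w => //.
by apply/(notin_closureP w P0); exists x.
Qed.

Lemma branches1_disjoint w : trivIset (branches [set w]).
Proof.
apply/trivIsetP => A B /branchesP[_ [x [/set1P-> _ ->]]].
case/branchesP=> _ [y [/set1P-> _ ->]]; apply: contraR => /pred0Pn[z /andP[/= zx zy]].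
by rewrite -(branch_eq zx) (branch_eq zy).
Qed.

(** A position is legal as long as some gate stays untouched. *)
Definition gates W := [set ~: C | C in [set C | maxset (mem (branches W)) C]].

Lemma legal_gates W P : P != set0 ->
  (W \subset closure_op convex P) = ~~ [exists B in gates W, [disjoint B & P]].
Proof.
move=> P0; rewrite legal_branches //; congr (~~ _); apply/exists_inP/exists_inP => -[C].
  move=> CW sPC; have [M maxM sCM] := maxset_exists (P := mem (branches W)) CW.
  exists (~: M); first by apply: imset_f; rewrite inE.
  by rewrite disjoint_sym disjoints_subset setCK (subset_trans sPC).
case/imsetP=> M; rewrite inE => /maxsetp MW -> dP; exists M => //.
by rewrite disjoint_sym disjoints_subset setCK in dP.
Qed.

(** Otherwise w together with the branch is a connected set avoiding w', which
    lies in a branch at w' that is strictly larger. *)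
Lemma max_branch W w w' x : x != w -> maxset (mem (branches W)) (branch w x) ->
  w' \in W -> w' != w -> w' \in branch w x.
Proof.
move=> xw /maxsetP[_ maxC] w'W w'w; apply: contraR (cut_notin_branch xw) => w'C.
have w'Z : w' \notin w |: branch w x by rewrite in_setU1 negb_or w'w.
have sZ := convex_sub_branch (branch_root_convex xw) w'Z (setU11 _ _).
rewrite -(maxC (branch w' w)) ?branch_refl //.
  by apply/branchesP; exists w', w; rewrite eq_sym.
exact: subset_trans (subsetUr _ _) sZ.
Qed.

(** Two maximal branches C at w and D at w' cover all vertices.  If w' = w, both
    contain any other point of W, so they coincide.  If not, the complement of C
    is connected, contains w and avoids w', since w' is in C; so it lies in the
    branch at w' containing w, and that branch is D. *)
Lemma gates_disjoint W : 1 < #|W| -> trivIset (gates W).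
Proof.
move=> W2; apply/trivIsetP => _ _ /imsetP[C maxC ->] /imsetP[D maxD ->].
rewrite disjoints_subset setCK; apply: contraR => nsCD.
apply/eqP; congr (~: _).
move: maxC maxD nsCD; rewrite !inE => maxC maxD.
have /branchesP[w [x [wW xw defC]]] := maxsetp maxC.
have /branchesP[w' [x' [w'W x'w' defD]]] := maxsetp maxD.
rewrite {}defC {}defD in maxC maxD *.
have [def_w'|w'w] := eqVneq w' w => [_|/negP[]].
  have [v] : exists v, v \in W :\ w.
    by apply/set0Pn; rewrite -card_gt0; move: W2; rewrite (cardsD1 w) wW.
  rewrite !inE => /andP[vw vW]; rewrite def_w' in x'w' maxD *.
  rewrite -(branch_eq (max_branch xw maxC vW vw)).
  by rewrite (branch_eq (max_branch x'w' maxD vW vw)).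
have wC' : w \in ~: branch w x by rewrite inE cut_notin_branch.
have w'C' : w' \notin ~: branch w x by rewrite in_setC negbK (max_branch xw maxC).
rewrite -(branch_eq (max_branch x'w' maxD wW _)) 1?eq_sym //.
by apply: convex_sub_branch; rewrite ?setC_branch_convex.
Qed.

Lemma gates_neq0 W : set0 \notin gates W.
Proof.
apply/imsetP => -[C]; rewrite inE => /maxsetp/branchesP[w [x [_ xw ->]]] /setP/(_ w).
by rewrite in_setC cut_notin_branch // inE.
Qed.

Lemma gates_exist W : 1 < #|W| -> gates W != set0.
Proof.
case/card_gt1P=> w [x [wW _ wx]].
have CW : mem (branches W) (branch w x) by apply/branchesP; exists w, x; rewrite eq_sym.
have [M maxM _] := maxset_exists CW.
by apply/set0Pn; exists (~: M); apply: imset_f; rewrite inE.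
Qed.

(** The two cases are the singleton, where the branches are cages, and the rest,
    where the gates are blockers. *)
Theorem nim_connected_graph W : W != set0 -> nim_DNG convex W <= 3.
Proof.
rewrite -card_gt0 leq_eqVlt => /predU1P[/esym/eqP/cards1P[w ->]|W2].
  apply: leq_trans (nim_caged_start _ _) _ => //; first exact: branches1_disjoint.
  exact: legal_branches.
apply: nim_blocked_start (gates_exist W2); first exact: gates_disjoint.
  exact: gates_neq0.
exact: legal_gates.
Qed.

End Branches.

(** * Path graphs, and the four values *)

Section PathGraph.
Variable n : nat.
Implicit Types (i j k w x z : 'I_n.+1).

Definition path_edge : rel 'I_n.+1 := fun i j => (i.+1 == j) || (j.+1 == i).

Lemma path_edge_sym : symmetric path_edge.
Proof. by move=> i j; rewrite /path_edge orbC. Qed.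

Lemma path_walk (Z : {set 'I_n.+1}) i j :
  i <= j -> (forall k, i <= k <= j -> k \in Z) -> connect (induced path_edge Z) i j.
Proof.
move=> le_ij; have [d] := ubnP (j - i); elim: d i le_ij => // d IHd i le_ij ltd sZ.
have [/val_inj->|neq_ij] := eqVneq (i : nat) j; first exact: connect0.
have lt_ij : i < j by rewrite ltn_neqAle neq_ij.
pose i' := Ordinal (leq_ltn_trans lt_ij (ltn_ord j)).
apply: (@connect_trans _ _ i').
  by apply: connect1; rewrite /= /path_edge eqxx !sZ ?leqnn ?leqnSn //= le_ij.
apply: IHd => // [|k /andP[ltik lekj]]; last by rewrite sZ // lekj ltnW.
by rewrite /= subnS -ltnS prednK ?subn_gt0.
Qed.

Lemma path_connected : connected_on [set: 'I_n.+1] path_edge.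
Proof.
have conn i j : i <= j -> connect path_edge i j.
  move=> le_ij; apply: (connect_sub _ (path_walk le_ij (fun k _ => in_setT k))) => u v.
  by case/and3P=> _ _; apply: connect1.
apply/'forall_in_forall_inP => i _ j _.
case/orP: (leq_total i j) => /conn //.
by rewrite (sym_connect_sym path_edge_sym).
Qed.

(** Both neighbours in a cycle of its largest vertex m must be m - 1, so they
    coincide, which a simple cycle of at least three vertices excludes. *)
Lemma path_acyclic (c : seq 'I_n.+1) : ucycle path_edge c -> size c <= 2.
Proof.
case: c => // x0 c; set s := x0 :: c; case/andP => cyc_s uniq_s.
case: (@arg_maxnP _ x0 (mem s) (@nat_of_ord n.+1)) => [|m ms max_m].
  exact: mem_head.
have [r s' def_s] := rot_to ms.
have mem_s : m :: s' =i s by move=> x; rewrite -def_s mem_rot.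
rewrite -(size_rot r) def_s.
move: cyc_s uniq_s; rewrite -(rot_cycle r) -(rot_uniq r) def_s.
case: s' mem_s {def_s} => [|a [|b t]] //= mem_s; rewrite rcons_path.
case/and4P=> ma _ _ tm /and3P[ms' a_t _].
have below x : x \in a :: b :: t -> path_edge m x -> x.+1 = m.
  move=> xs; have : x <= m by apply: max_m; rewrite /= -mem_s inE xs orbT.
  by rewrite /path_edge => le_xm /orP[/eqP def_x|/eqP//]; rewrite -def_x ltnn in le_xm.
case/negP: a_t; suff -> : a = last b t by apply: mem_last.
apply/val_inj/succn_inj; rewrite !below ?mem_head //; last by rewrite path_edge_sym.
by rewrite inE mem_last orbT.
Qed.

Lemma path_tree : tree path_edge.
Proof.
split; last exact: path_acyclic; last exact: path_connected.
- exact: path_edge_sym.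
- by move=> i; rewrite /path_edge orbb gtn_eqF.
by rewrite card_ord.
Qed.

Lemma path_branchE w x z : x != w ->
  (z \in branch path_edge w x) = (z != w) && ((z < w) == (x < w)).
Proof.
move=> xw; apply/idP/andP => [zB | [zw /eqP side]].
  split; first by apply: contraTneq zB => ->; apply: cut_notin_branch.
  move: zB; rewrite inE => xz; apply/eqP/esym.
  suff cl : closed (induced path_edge [set~ w]) [pred i : 'I_n.+1 | i < w].
    by have := closed_connect cl xz; rewrite !inE.
  move=> i j /and3P[]; rewrite !inE -!val_eqE /= => iw jw.
  by case/orP=> /eqP def; apply/idP/idP; lia.
have far i j : i <= j -> i != w -> j != w -> (i < w) = (j < w) ->
    connect (induced path_edge [set~ w]) i j.
  rewrite -!val_eqE /= => le_ij iw jw side_ij; apply: path_walk => // k.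
  by rewrite !inE -val_eqE /=; lia.
rewrite inE; case/orP: (leq_total x z) => le; first exact: far.
by rewrite branch_sym; [apply: far | apply: path_edge_sym].
Qed.

Variable y : 'I_n.+1.
Hypothesis y_gt0 : 0 < y.

Definition beyond := [set z : 'I_n.+1 | y <= z].

(** The branches at the end ord0 and at y that matter are the complement of ord0
    and the part of the path before y; the part after y avoids ord0. *)
Lemma path_legal (P : {set 'I_n.+1}) : P != set0 ->
  ([set ord0; y] \subset closure_op (vertex_geometry path_edge) P)
    = ~~ [exists B in [set [set ord0]; beyond], [disjoint B & P]].
Proof.
move=> P0; rewrite -[LHS]negbK; congr (~~ _).
have y0 : ord0 != y by rewrite -val_eqE /= ltn_eqF.
have out B : B \in [set [set ord0]; beyond] -> (forall z, z \in P -> z \notin B) ->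
    exists2 B, B \in [set [set ord0]; beyond] & [disjoint B & P].
  move=> BF PB; exists B => //; rewrite disjoint_sym disjoints_subset.
  by apply/subsetP => z zP; rewrite inE PB.
have closP := notin_closureP path_edge_sym _ P0.
apply/subsetPn/exists_inP => [[w /set2P[]-> /closP[x xw sP]] | [B]].
- apply: (out [set ord0]); rewrite ?set21 // => z /(subsetP sP).
  by rewrite path_branchE // inE => /andP[].
- have [zeroP | zeroP] := boolP (ord0 \in P); last first.
    apply: (out [set ord0]); rewrite ?set21 // => z; rewrite inE.
    by apply: contraTneq => ->.
  apply: (out beyond); rewrite ?set22 // => z /(subsetP sP).
  have := subsetP sP _ zeroP; rewrite !path_branchE // y0 /= y_gt0 => /eqP <-.
  by rewrite inE -ltnNge => /andP[_ /eqP].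
case/set2P=> ->; rewrite disjoint_sym disjoints_subset => /subsetP PB.
  have [x xP] := set0Pn _ P0.
  exists ord0; first exact: set21.
  apply/closP; exists x; first by move/PB: xP; rewrite !inE.
  apply/subsetP => z zP; rewrite path_branchE; last by move/PB: xP; rewrite !inE.
  by move/PB: zP; rewrite !inE => ->; rewrite !ltn0.
exists y; first exact: set22.
apply/closP; exists ord0 => //.
apply/subsetP => z /PB; rewrite path_branchE // !inE -ltnNge y_gt0 => zy.
by rewrite zy -val_eqE ltn_eqF.
Qed.

Lemma nim_path :
  nim_DNG (vertex_geometry path_edge) [set ord0; y]
    = if odd n == odd y then odd y : nat else 2 + ~~ odd y.
Proof.
have neq : [set ord0] != beyond.
  by apply/eqP => /setP/(_ y); rewrite !inE leqnn -val_eqE /= gtn_eqF.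
have dis : trivIset [set [set ord0]; beyond].
  have d : [disjoint [set ord0] & beyond] by rewrite disjoints1 inE -ltnNge.
  apply/trivIsetP => A B /set2P[]-> /set2P[]->; rewrite ?eqxx //.
  by rewrite disjoint_sym.
have nz : set0 \notin [set [set ord0]; beyond].
  rewrite !inE negb_or ![set0 == _]eq_sym -!card_gt0 cards1.
  by apply/card_gt0P; exists y; rewrite inE.
have card0 : #|~: [set ord0 : 'I_n.+1]| = n by rewrite cardsC1 card_ord.
have cardy : #|~: beyond| = y.
  rewrite -[RHS]card_ord -!sum1_card (big_ord_widen n.+1 (fun=> 1)) 1?ltnW //.
  by apply: eq_bigl => z; rewrite !inE -ltnNge.
have card0y : #|~: ([set ord0] :|: beyond)| = y.-1.
  rewrite -cardy (cardsD1 ord0 (~: beyond)) !inE -ltnNge y_gt0 /=.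
  by apply: eq_card => z; rewrite !inE negb_or.
rewrite /nim_DNG (nim_blocked_pair_start dis nz path_legal erefl neq).
rewrite card0 cardy card0y -[in odd y](prednK y_gt0) /= negbK.
by case: eqP => // ->.
Qed.

End PathGraph.

Theorem corollary33 (n : nat) :
  (exists (S : finType) (e : rel S) (W : {set S}),
     [/\ tree e, W != set0 & nim_DNG (vertex_geometry e) W = n])
  <-> n \in [:: 0; 1; 2; 3].
Proof.
split=> [[S [e [W [[sym_e _ _ conn_e _] W0 <-]]]] | ].
  by have := nim_connected_graph sym_e conn_e W0; case: (nim_DNG _ _) => [|[|[|[]]]].
have ex m (y : 'I_m.+1) : 0 < y ->
    exists (S : finType) (e : rel S) (W : {set S}),
    [/\ tree e, W != set0 & nim_DNG (vertex_geometry e) W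
        = if odd m == odd y then odd y : nat else 2 + ~~ odd y].
  move=> y_gt0; exists 'I_m.+1, (@path_edge m), [set ord0; y].
  by rewrite nim_path // setU1_neq0; split=> //; apply: path_tree.
rewrite !inE => /or4P[] /eqP->.
(* The witness [ex m y] is the path on m + 1 vertices 0, ..., m. *)
- exact: (ex 2 ord_max).
- exact: (ex 1 ord_max).
- exact: (ex 2 (@Ordinal 3 1 isT)).
- exact: (ex 3 (@Ordinal 4 2 isT)).
Qed.
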